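(* Under full information feedback, the OGD-CB algorithm $\beta$ guarantees \[\liminf_{T\to\infty,\ B=\rho T}\ \inf_{\bm v,\,G}\ \frac1T\,\mathbb E_{\bm p\sim G^T}\Big[R^\beta(\bm v,\bm p)-\frac{\rho}{\bar v}\,R^{\mathrm H}(\bm v,\bm p)\Big]\ \ge 0,\] where the infimum is over value sequences $\bm v\in[0,\bar v]^T$ and distributions $G$ on $[0,\bar v]$.
   Context: Model: constants $\bar v>0$, $\rho\in(0,\bar v]$; $T$ rounds; budget $B=\rho T$. Round $t$: value $v_t\in[0,\bar v]$ (an arbitrary, adversarial sequence); highest competing bid $p_t$ i.i.d. from an unknown distribution $G$ on $[0,\bar v]$. Buyer chooses $x_t\in\{0,1\}$, receives $x_tr_t$ with $r_t=(v_t-p_t)^+$, pays $x_tc_t$ with $c_t=p_t\mathbf 1[v_t\ge p_t]$. Full information: $p_t$ observed at the end of every round. Revenue $R^\beta(\bm v,\bm p)=\sum_{t=1}^{T_0}x_tr_t$, $T_0$ the ending time. Hindsight benchmark: $R^{\mathrm H}(\bm v,\bm p)=\max_{\bm x\in\{0,1\}^T}\sum_tx_t(v_t-p_t)^+$ s.t. $\sum_tx_tp_t\mathbf 1[v_t\ge p_t]\le T\rho$. OGD-CB algorithm: $\mathcal I_1=\emptyset$, $B_1=B$, $\lambda_1=0$. For $t=1,\dots,T$: observe $v_t$. If $t=1$: $x_1=1$, $\lambda_2=\lambda_1$. Otherwise: $\epsilon_t=\sqrt{(\ln 2+2\ln T)/(2|\mathcal I_t|)}$; $\tilde r_t(v)=\frac1{|\mathcal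 I_t|}\sum_{\tau\in\mathcal I_t}(v-p_\tau)^++\epsilon_tv$; $\tilde c_t(v)=\frac1{|\mathcal I_t|}\sum_{\tau\in\mathcal I_t}p_\tau\mathbf 1[v\ge p_\tau]-2\epsilon_tv$; $x_t=\mathbf 1[\tilde r_t(v_t)\ge\lambda_t\tilde c_t(v_t)]$; $\eta_t=1/(\bar v\sqrt t)$; $\lambda_{t+1}=(\lambda_t+\eta_t(x_t\tilde c_t(v_t)-\rho))^+$. Observe $p_t$ and set $\mathcal I_{t+1}=\mathcal I_t\cup\{t\}$. Set $B_{t+1}=B_t-x_tc_t$; if $B_{t+1}<\bar v$, stop; $T_0$ is the stopping round (or $T$). *)

(* Defs.v *)
From HB Require Import structures.
From mathcomp Require Import all_boot all_order all_algebra.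
From mathcomp Require Import all_classical all_reals all_analysis.
Set Implicit Arguments. Unset Strict Implicit. Unset Printing Implicit Defensive.
Import Order.TTheory GRing.Theory Num.Theory.
Local Open Scope ring_scope.

Section OGDCB.
Variable R : realType.

Definition rwd (v p : R) : R := Num.max (v - p) 0.
Definition cst (v p : R) : R := if p <= v then p else 0.

(* Rounds are 0-indexed: round k (k = 0..T-1) is the paper's round t = k+1.
   With full information, I_t = {1,..,t-1}, i.e. 0-indexed {0,..,k-1}, |I_t| = k. *)
Variables (vbar rho : R) (T : nat) (v p : nat -> R).

Definition eps_t (k : nat) : R :=
  Num.sqrt ((ln 2 + 2 * ln T%:R) / (2 * k%:R)).
Definition eta_t (k : nat) : R := (vbar * Num.sqrt (k.+1)%:R)^-1.
Definition rtil (k : nat) (x : R) : R :=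
  (k%:R)^-1 * (\sum_(j < k) rwd x (p j)) + eps_t k * x.
Definition ctil (k : nat) (x : R) : R :=
  (k%:R)^-1 * (\sum_(j < k) cst x (p j)) - 2 * eps_t k * x.

Definition ogd_step (s : R * R * bool * R) (k : nat) : R * R * bool * R :=
  let '(lam, bud, stp, rev) := s in
  if stp then s else
  let x : bool := if k == 0%N then true
                  else lam * ctil k (v k) <= rtil k (v k) in
  let lam' := if k == 0%N then lam
              else Num.max (lam + eta_t k * ((if x then ctil k (v k) else 0) - rho)) 0 in
  let bud' := if x then bud - cst (v k) (p k) else bud in
  let rev' := if x then rev + rwd (v k) (p k) else rev in
  (lam', bud', bud' < vbar, rev').

Fixpoint ogd_run (n : nat) : R * R * bool * R :=
  match n with
  | 0 => (0, rho * T%:R, false, 0)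
  | n.+1 => ogd_step (ogd_run n) n
  end.

Definition ogdcb_revenue : R := (ogd_run T).2.

Definition hindsight : R :=
  \big[Num.max/0]_(x : {ffun 'I_T -> bool} |
      \sum_(i < T) (if x i then cst (v i) (p i) else 0) <= T%:R * rho)
    (\sum_(i < T) (if x i then rwd (v i) (p i) else 0)).

End OGDCB.

Fixpoint Eprod (R : realType) (G : probability R R) (n : nat)
    (f : seq R -> R) : R :=
  match n with
  | 0 => f [::]
  | n.+1 => Rintegral G setT (fun x => Eprod G n (fun s => f (x :: s)))
  end.

(* Main.v *)
(** The benchmark earns at most [sum_t r_t], so it suffices to compare with the
    strategy that buys with probability [rho / vbar] in every round; its average
    cost never exceeds [rho].  The decision [x_t] maximises the estimated
    Lagrangian, hence beats this comparator round by round, up to the error of the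
    estimates and a term [multiplier * gradient].  The latter is controlled by the
    [O(sqrt T * ln T)] regret of projected gradient descent against the multiplier
    [0] if the budget survives, and against [1] if it is exhausted: in that case
    the cost actually paid, at least [rho T - vbar], compensates for the rounds
    that are lost.  Since [v_t] is fixed in advance, the estimation errors and the
    gaps between realised and mean rewards and costs are martingales in the prices,
    and their second moments suffice: no concentration inequality is needed.  The
    expectation is bounded through a supermartingale made of squared martingales. *)
Require Import Defs.
From HB Require Import structures.
From mathcomp Require Import all_boot all_order all_algebra.
From mathcomp Require Import all_classical all_reals all_analysis.
From mathcomp Require Import measurable_realfun.
From mathcomp Require Import ring lra.
Set Implicit Arguments. Unset Strict Implicit. Unset Printing Implicit Defensive.
Import Order.TTheory GRing.Theory Num.Theory.
Local Open Scope ring_scope.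
Local Open Scope classical_set_scope.

(** * Lower integrals and iterated expectations *)

Section LowerIntegral.
Local Open Scope ereal_scope.
Context d (T : measurableType d) (R : realType).
Variables (mu : {measure set T -> \bar R}) (D : set T).
Hypotheses (mD : measurable D) (muDC : mu (~` D) = 0).
Import HBNNSimple.

(** The integral of [f] is a supremum over simple functions below it, and each of these may be
    integrated over [D] alone because the complement is null. *)
Lemma ge0_integral_le_null (f g : T -> \bar R) :
    (forall x, 0 <= f x) -> measurable_fun D g ->
    (forall x, D x -> f x <= g x) ->
  \int[mu]_x f x <= \int[mu]_(x in D) g x.
Proof.
move=> f0 mg fg; rewrite ge0_integralTE//.
apply: ge_ereal_sup => /= _ [h /= hf <-].
have mh : measurable_fun setT (EFin \o h) by exact/measurable_EFinP.
rewrite -integralT_nnsfun (@ge0_negligible_integral _ _ _ mu setT (~` D))//.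
- rewrite setTD setCK; apply: ge0_le_integral => //.
  + by move=> x _; rewrite lee_fin.
  + exact: measurable_funS mh.
  + by move=> x Dx; exact: le_trans (hf x) (fg x Dx).
- exact: measurableC.
- by move=> x _; rewrite lee_fin.
Qed.

(** A simple function below [g] extended by [0] outside [D] is also below [f], so the supremum for
    [f] ranges over a larger set. *)
Lemma ge0_integral_ge (f g : T -> \bar R) :
    (forall x, 0 <= f x) -> (forall x, D x -> 0 <= g x) ->
    (forall x, D x -> g x <= f x) ->
  \int[mu]_(x in D) g x <= \int[mu]_x f x.
Proof.
move=> f0 g0 gf; rewrite integral_mkcond !ge0_integralTE//; last first.
  by move=> x; exact: erestrict_ge0.
apply: ereal_sup_le => _ /= [h hg <-]; exists h => // x.
apply: le_trans (hg x) _; rewrite /patch.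
by case: ifPn => // /set_mem; exact: gf.
Qed.

End LowerIntegral.

Section ProbabilityBounds.
Context d (T : measurableType d) (R : realType).
Variables (P : probability T R) (D : set T).
Hypotheses (mD : measurable D) (PD : P D = 1%E).

Lemma bounded_integrable (f : T -> R) (C : R) :
  measurable_fun D f -> (forall x, D x -> `|f x| <= C) ->
  P.-integrable D (EFin \o f).
Proof.
move=> mf fC; have Poo : (P D < +oo)%E by rewrite PD ltry.
apply: (measurable_bounded_integrable mD Poo mf).
exists C; split; first exact: num_real.
by move=> M CM x Dx; exact: le_trans (fC _ Dx) (ltW CM).
Qed.

Lemma probability_setC_null : P (~` D) = 0%E.
Proof. by rewrite probability_setC// PD subee. Qed.

(* [f] need not be measurable: [integral] is then the difference of the lower
   integrals of its positive and negative parts, which is still monotone. *)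
Lemma Rintegral_bounds (f g : T -> R) (K C : R) : 0 <= C ->
    measurable_fun D g -> (forall x, D x -> `|g x| <= K) ->
    (forall x, D x -> g x <= f x <= C) ->
  Rintegral P D g <= Rintegral P setT f <= C.
Proof.
move=> C0 mg gK gf.
have PDC := probability_setC_null.
have ig := bounded_integrable mg gK.
have mg' : measurable_fun D (EFin \o g) by exact/measurable_EFinP.
set F := (EFin \o f); set g' := (EFin \o g).
have gF x : D x -> (g' x <= F x)%E by move=> /gf/andP[+ _]; rewrite lee_fin.
have h1 : (\int[P]_(x in D) g'^\+ x <= \int[P]_x F^\+ x)%E.
  apply: ge0_integral_ge => // x Dx.
  by apply: (@funepos_le _ _ D); [move=> y /set_mem; exact: gF|exact/mem_set].
have h2 : (\int[P]_x F^\+ x <= C%:E)%E.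
  have -> : C%:E = (\int[P]_(x in D) (cst C%:E) x)%E.
    by rewrite integral_cst// -[LHS]mule1; congr (_ * _)%E; exact/esym.
  apply: ge0_integral_le_null => // x /gf/andP[_ fC].
  by rewrite funeposE ge_max !lee_fin fC.
have h3 : (\int[P]_x F^\- x <= \int[P]_(x in D) g'^\- x)%E.
  apply: ge0_integral_le_null => //; first exact: measurable_funeneg.
  move=> x Dx; apply: (@funeneg_le _ _ D); last exact/mem_set.
  by move=> y /set_mem; exact: gF.
(* [Rintegral] applies [fine], which is monotone only between finite values: [C] makes the positive
   part of [F] finite, and [g] the negative part. *)
have h4 : (\int[P]_(x in D) g'^\- x)%E \is a fin_num.
  exact/integrable_fin_num/integrable_funeneg.
have h0 : (0 <= \int[P]_x F^\+ x)%E by exact: integral_ge0.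
have h5 : (0 <= \int[P]_x F^\- x)%E by exact: integral_ge0.
have f1 : (\int[P]_x F^\+ x)%E \is a fin_num.
  by rewrite ge0_fin_numE// (le_lt_trans h2)// ltry.
have f2 : (\int[P]_x F^\- x)%E \is a fin_num.
  by rewrite ge0_fin_numE// (le_lt_trans h3)// -ge0_fin_numE ?(le_trans h5).
have fF : (\int[P]_x F x)%E \is a fin_num by rewrite integralE fin_numB f1 f2.
rewrite /Rintegral -/F -/g'; apply/andP; split.
  apply: fine_le => //; first exact: integrable_fin_num.
  by rewrite integralE [leRHS]integralE; exact: leeB.
rewrite -lee_fin fineK// integralE.
by apply: le_trans h2; rewrite -[leRHS]sube0; exact: leeB.
Qed.

End ProbabilityBounds.

(** * Supermartingales along finite histories, and iterated expectations *)

Section Supermartingale.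
Variables (R : realType) (P : probability R R) (D : set R).
Hypotheses (mD : measurable D) (PD : P D = 1%E).
Variable T : nat.

(* A process is a function of the finite history of draws; [D] carries [P]. *)
Definition supermartingale (X : seq R -> R) :=
  forall s : seq R, (forall x, x \in s -> D x) -> (size s < T)%N ->
  [/\ measurable_fun D (fun x => X (rcons s x)),
      exists K, forall x, D x -> `|X (rcons s x)| <= K
    & Rintegral P D (fun x => X (rcons s x)) <= X s].

Lemma Rintegral_prob_cst (c : R) : Rintegral P D (fun=> c) = c.
Proof.
rewrite Rintegral_cst//.
have -> : fine (P D) = 1 by rewrite PD.
by rewrite mulr1.
Qed.

Lemma supermartingale_cst c : supermartingale (fun=> c).
Proof.
move=> s _ _; split; first exact: measurable_cst.
- by exists `|c|.
- by rewrite Rintegral_prob_cst.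
Qed.

Lemma supermartingaleD X Y :
  supermartingale X -> supermartingale Y -> supermartingale (X \+ Y).
Proof.
move=> hX hY s sD sT.
have [mX [K XK] IX] := hX s sD sT; have [mY [L YL] IY] := hY s sD sT.
split; first exact: measurable_funD.
- exists (K + L) => x Dx; apply: le_trans (ler_normD _ _) _.
  by rewrite lerD ?XK ?YL.
- rewrite RintegralD ?lerD//.
  + exact: bounded_integrable mX XK.
  + exact: bounded_integrable mY YL.
Qed.

Lemma supermartingaleZ (a : R) X :
  0 <= a -> supermartingale X -> supermartingale (fun s => a * X s).
Proof.
move=> a0 hX s sD sT; have [mX [K XK] IX] := hX s sD sT.
split; first by apply: measurable_funM => //; exact: measurable_cst.
- exists (a * K) => x Dx; rewrite normrM ger0_norm//.
  by rewrite ler_wpM2l ?XK.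
- rewrite RintegralZl ?ler_wpM2l//; exact: bounded_integrable mX XK.
Qed.

Lemma supermartingale_sum (I : Type) (r : seq I) (X : I -> seq R -> R) :
  (forall i, supermartingale (X i)) ->
  supermartingale (fun s => \sum_(i <- r) X i s).
Proof.
move=> hX; elim: r => [|i r IH].
  under eq_fun do rewrite big_nil; exact: supermartingale_cst.
under eq_fun do rewrite big_cons; exact: supermartingaleD.
Qed.

(* Only the potential [X] has to be measurable, never [f] nor its iterated
   partial integrals. *)
Lemma Eprod_ge (X f : seq R -> R) (c C : R) :
    (forall s, 0 <= X s) -> supermartingale X -> 0 <= C -> c <= C ->
    (forall s, (forall x, x \in s -> D x) -> size s = T ->
      c - X s <= f s <= C) ->
  c - X [::] <= Eprod P T f.
Proof.
move=> X0 hX C0 cC hf.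
(* The upper bound [C] is carried along since [Rintegral_bounds] asks for it at every level. [Eprod]
   conses its draws while histories grow by [rcons], hence the explicit prefix [s]. *)
suff H n s : (forall x, x \in s -> D x) -> (size s + n = T)%N ->
    c - X s <= Eprod P n (fun t => f (s ++ t)) <= C.
  by have /andP[] := H T [::] (fun x => ltac:(by [])) (erefl _).
elim: n s => [|n IH] s sD sT; first by rewrite /= cats0 hf// -sT addn0.
have sltT : (size s < T)%N by rewrite -sT -addSnnS leq_addr.
have [mX [K XK] IX] := hX s sD sltT.
have step : Rintegral P D (fun x => c - X (rcons s x)) <=
    Rintegral P setT (fun x => Eprod P n (fun t => f (s ++ x :: t))) <= C.
  apply: (@Rintegral_bounds _ _ _ P D mD PD _ _ (`|c| + K)) => //.
  - by apply: measurable_funB => //; exact: measurable_cst.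
  - move=> x Dx; apply: le_trans (ler_normB _ _) _.
    by rewrite lerD2l XK.
  - move=> x Dx; under eq_fun do rewrite -cat_rcons.
    apply: IH; last by rewrite size_rcons addSnnS.
    by move=> y; rewrite mem_rcons in_cons => /predU1P[->//|]; exact: sD.
case/andP: step => h1 h2; rewrite /= h2 andbT; apply: le_trans h1.
rewrite RintegralB//; last 2 first.
- exact: (bounded_integrable mD PD (measurable_cst c) (fun x _ => lexx `|c|)).
- exact: bounded_integrable mX XK.
by rewrite Rintegral_prob_cst lerD2l lerN2.
Qed.

End Supermartingale.

(** * Squares of martingales with adapted weights *)

Section SquareMartingale.
Variables (R : realType) (P : probability R R) (D : set R).
Hypotheses (mD : measurable D) (PD : P D = 1%E).
Variables (V : R) (h : nat -> R -> R).
Hypothesis mh : forall k, measurable_fun D (h k).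
Hypothesis h01 : forall k x, D x -> 0 <= h k x <= V.

Definition mean k := Rintegral P D (h k).

Lemma bounded_h_integrable k : P.-integrable D (EFin \o h k).
Proof.
apply: (bounded_integrable mD PD (mh k) (C := V)) => x Dx.
by have /andP[h0 hV] := h01 k Dx; rewrite ger0_norm.
Qed.

Lemma mean_bounds k : 0 <= mean k <= V.
Proof.
apply/andP; split.
  by apply: Rintegral_ge0 => x /h01-/(_ k)/andP[].
rewrite -[leRHS](Rintegral_prob_cst mD PD); apply: le_Rintegral => //.
- exact: bounded_h_integrable.
- exact: (bounded_integrable mD PD (measurable_cst V) (fun x _ => lexx `|V|)).
- by move=> x /h01-/(_ k)/andP[].
Qed.

Variable w : (nat -> R) -> nat -> R.
Hypothesis w_adapted : forall p q k,
  (forall j, (j < k)%N -> p j = q j) -> w p k = w q k.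

Definition martingale (p : nat -> R) n := \sum_(k < n) w p k * (h k (p k) - mean k).

Variables (T : nat) (b : nat -> R).
Hypothesis w_bound : forall p k, w p k ^+ 2 <= b k.

(** Given the history [s], this bounds the conditional expectation of the final squared martingale:
    increments are orthogonal, and the [j]-th has second moment at most [V ^+ 2 * b j]. *)
Definition square_potential (s : seq R) :=
  martingale (fun t => nth 0 s t) (size s) ^+ 2
  + V ^+ 2 * \sum_(size s <= j < T) b j.

Lemma square_potential_ge0 s : 0 <= square_potential s.
Proof.
rewrite addr_ge0 ?sqr_ge0// mulr_ge0 ?sqr_ge0//.
apply: sumr_ge0 => j _; apply: le_trans (w_bound (fun=> 0) j).
exact: sqr_ge0.
Qed.

Lemma martingale_rcons s x :
  martingale (fun t => nth 0 (rcons s x) t) (size s).+1 =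
  martingale (fun t => nth 0 s t) (size s)
  + w (fun t => nth 0 s t) (size s) * (h (size s) x - mean (size s)).
Proof.
rewrite /martingale big_ord_recr /= nth_rcons ltnn eqxx; congr (_ + _ * _).
  apply: eq_bigr => k _; rewrite nth_rcons ltn_ord; congr (_ * _).
  by apply: w_adapted => j jk; rewrite nth_rcons (ltn_trans jk).
by apply: w_adapted => j js; rewrite nth_rcons js.
Qed.

(** In the expanded square the cross term has mean zero, and the squared increment is at most
    [V ^+ 2 * b k], exactly the summand that leaves the tail. *)
Lemma square_potential_supermartingale :
  supermartingale P D T square_potential.
Proof.
move=> s sD sT; set k := size s.
set m := martingale (fun t => nth 0 s t) k; set wk := w (fun t => nth 0 s t) k.
set c := V ^+ 2 * \sum_(k.+1 <= j < T) b j.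
have XE x : square_potential (rcons s x) = (m + wk * (h k x - mean k)) ^+ 2 + c.
  by rewrite /square_potential size_rcons martingale_rcons.
have h_sub x : D x -> `|h k x - mean k| <= V.
  move=> /h01-/(_ k)/andP[h0 hV]; have /andP[a0 aV] := mean_bounds k.
  by rewrite ler_norml; lra.
have mX : measurable_fun D
    (fun x => (m + wk * (h k x - mean k)) ^+ 2 + c).
  apply: measurable_funD; last exact: measurable_cst.
  apply: measurable_funX; apply: measurable_funD; first exact: measurable_cst.
  apply: measurable_funM; first exact: measurable_cst.
  apply: measurable_funB => //; exact: measurable_cst.
have XK x : D x -> `|(m + wk * (h k x - mean k)) ^+ 2 + c| <=
    (`|m| + `|wk| * V) ^+ 2 + `|c|.
  move=> Dx; apply: le_trans (ler_normD _ _) _; rewrite lerD2r normrX.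
  rewrite ler_sqr ?nnegrE ?normr_ge0//; last first.
    rewrite addr_ge0 ?mulr_ge0//.
    by have /andP[h0 hV] := h01 k Dx; exact: le_trans hV.
  apply: le_trans (ler_normD _ _) _; rewrite lerD2l normrM.
  by rewrite ler_wpM2l// h_sub.
rewrite (funext XE); split => //.
  by exists ((`|m| + `|wk| * V) ^+ 2 + `|c|) => x Dx; rewrite XE XK.
have iX := bounded_integrable mD PD mX XK.
(* [A + 2 * m * wk * h k x] is the expanded square with the squared increment replaced by its bound;
   being affine in [h k x], it has an explicit integral. *)
pose A := m ^+ 2 + wk ^+ 2 * V ^+ 2 + c - 2 * m * wk * mean k.
have iA : P.-integrable D (EFin \o (fun=> A)).
  exact: (bounded_integrable mD PD (measurable_cst A) (fun x _ => lexx `|A|)).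
have iB : P.-integrable D (EFin \o (fun x => 2 * m * wk * h k x)).
  apply: (bounded_integrable mD PD (C := `|2 * m * wk| * V)).
    by apply: measurable_funM => //; exact: measurable_cst.
  move=> x Dx; rewrite normrM ler_wpM2l//.
  by have /andP[h0 hV] := h01 k Dx; rewrite ger0_norm.
have iAB : P.-integrable D (EFin \o (fun x => A + 2 * m * wk * h k x)).
  exact: (@integrableD _ _ _ P D mD _ _ iA iB).
apply: (@le_trans _ _ (Rintegral P D (fun x => A + 2 * m * wk * h k x))).
  apply: le_Rintegral => // x Dx.
  have : (h k x - mean k) ^+ 2 <= V ^+ 2.
    by have /ler_normlP[] := h_sub x Dx; nra.
  move=> /(ler_wpM2l (sqr_ge0 wk)); rewrite /A; lra.
rewrite RintegralD// Rintegral_prob_cst// RintegralZl//; last first.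
  exact: bounded_h_integrable.
rewrite -/(mean k) /square_potential -/k -/m [in leRHS]big_ltn// mulrDr -/c /A.
have := ler_wpM2l (sqr_ge0 V) (w_bound (fun t => nth 0 s t) k).
rewrite -/wk; lra.
Qed.

End SquareMartingale.

(** * A sample path of the algorithm *)

Section Run.
Variables (R : realType) (vbar rho : R) (T : nat) (v p : nat -> R).
Hypotheses (vbar_gt0 : 0 < vbar) (rho_gt0 : 0 < rho) (rho_le : rho <= vbar).
Hypothesis v_bounds : forall t, 0 <= v t <= vbar.
Hypothesis p_bounds : forall t, 0 <= p t <= vbar.

Local Notation run := (ogd_run vbar rho T v p).
Definition multiplier n := (run n).1.1.1.
Definition budget n := (run n).1.1.2.
Definition stopped n := (run n).1.2.
Definition revenue n := (run n).2.
Definition buys k := multiplier k * ctil T p k (v k) <= rtil T p k (v k).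
(** Real-valued, so that it serves both as a martingale weight and as a cut-off: sums may then run
    over all rounds even if the run stops early. *)
Definition active k : R := (~~ stopped k)%:R.
Definition bought k : R := active k * (buys k)%:R.
Definition dual_grad k := (buys k)%:R * ctil T p k (v k) - rho.

Lemma rtil0 x : rtil T p 0 x = 0.
Proof. by rewrite /rtil /eps_t mulr0 invr0 mulr0 sqrtr0 !mul0r addr0. Qed.

Lemma ctil0 x : ctil T p 0 x = 0.
Proof. by rewrite /ctil /eps_t mulr0 invr0 mulr0 sqrtr0 mulr0 !mul0r subr0. Qed.

Lemma eta_gt0 k : 0 < eta_t vbar k.
Proof. by rewrite /eta_t invr_gt0 mulr_gt0// sqrtr_gt0 ltr0n. Qed.

(* The first round obeys the general rule: both estimates are then [0], by the
   convention [0^-1 = 0]. *)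
Lemma run_step k : ~~ stopped k ->
  [/\ multiplier k.+1 =
        Num.max (multiplier k + eta_t vbar k * dual_grad k) 0,
      budget k.+1 = budget k - (buys k)%:R * Defs.cst (v k) (p k),
      stopped k.+1 = (budget k.+1 < vbar)
    & revenue k.+1 = revenue k + (buys k)%:R * rwd (v k) (p k)].
Proof.
rewrite /stopped /multiplier /budget /revenue /dual_grad /buys /multiplier.
case: k => [|k] /=.
  rewrite /= ctil0 rtil0 !mulr0 lexx /= !mul1r add0r sub0r => _.
  (* In round [0] the gradient is [- rho], and the projection sends the multiplier back to its
     initial value [0]. *)
  split => //; apply/esym/max_idPr.
  by rewrite mulrN oppr_le0 mulr_ge0 ?ltW ?eta_gt0.
rewrite /=.
case: (ogd_step _ _ _ _ _ (ogd_run _ _ _ _ _ k) k) => [[[lam bud] []] rev] //= _.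
by case: ifP => _; rewrite ?mul1r ?mul0r ?subr0 ?addr0.
Qed.

Lemma run_stopped k : stopped k -> run k.+1 = run k.
Proof.
rewrite /stopped /=.
by case: (ogd_run _ _ _ _ _ k) => [[[lam bud] []] rev].
Qed.

Lemma stopped_mono k n : (k <= n)%N -> stopped k -> stopped n.
Proof.
elim: n => [|n IH]; first by rewrite leqn0 => /eqP->.
rewrite leq_eqVlt => /predU1P[->//|]; rewrite ltnS => kn sk.
by have sn := IH kn sk; rewrite /stopped run_stopped.
Qed.

Lemma stopped_budget n : stopped n -> budget n < vbar.
Proof.
elim: n => [//|n IH].
have [sn|sn] := boolP (stopped n); last by have [_ _ -> _] := run_step sn.
by rewrite /stopped /budget run_stopped//; exact: IH.
Qed.

Lemma revenueE n : revenue n = \sum_(k < n) bought k * rwd (v k) (p k).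
Proof.
elim: n => [|n IH]; first by rewrite big_ord0.
rewrite big_ord_recr /= -IH /bought /active.
have [sn|sn] := boolP (stopped n).
  by rewrite !mul0r addr0 /revenue run_stopped.
by rewrite mul1r; have [_ _ _] := run_step sn.
Qed.

Lemma budgetE n :
  budget n = rho * T%:R - \sum_(k < n) bought k * Defs.cst (v k) (p k).
Proof.
elim: n => [|n IH]; first by rewrite big_ord0 subr0.
rewrite big_ord_recr /= opprD addrA -IH /bought /active.
have [sn|sn] := boolP (stopped n).
  by rewrite !mul0r subr0 /budget run_stopped.
by rewrite mul1r; have [] := run_step sn.
Qed.

Lemma multiplier_ge0 n : 0 <= multiplier n.
Proof.
elim: n => [//|n IH].
have [sn|sn] := boolP (stopped n); first by rewrite /multiplier run_stopped.
by have [-> _ _ _] := run_step sn; rewrite le_max lexx orbT.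
Qed.

Lemma rwd_bounds x y : 0 <= x <= vbar -> 0 <= y -> 0 <= rwd x y <= vbar.
Proof.
move=> /andP[x0 xv] y0; rewrite /rwd le_max lexx orbT ge_max; lra.
Qed.

Lemma cst_bounds x y : 0 <= y <= vbar -> 0 <= Defs.cst x y <= vbar.
Proof. by move=> yb; rewrite /Defs.cst; case: ifP => // _; rewrite lexx ltW. Qed.

(** * Bounds on the estimates, the gradient and the multiplier *)

Definition log_rate : R := Num.sqrt (ln 2 + 2 * ln T%:R).

Lemma log_arg_ge0 : 0 <= ln 2 + 2 * ln T%:R :> R.
Proof.
case: T => [|n]; first by rewrite [ln 0%:R]ln0 ?mulr0n// mulr0 addr0 ln_ge0// ler1n.
by rewrite addr_ge0 ?mulr_ge0// ln_ge0// ler1n.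
Qed.

Lemma log_rate_ge0 : 0 <= log_rate.
Proof. exact: sqrtr_ge0. Qed.

Lemma eps_ge0 k : 0 <= eps_t R T k.
Proof. exact: sqrtr_ge0. Qed.

Lemma eps_le_rate k : eps_t R T k <= log_rate / Num.sqrt k%:R.
Proof.
rewrite /eps_t /log_rate -sqrtrV ?ler0n// -sqrtrM ?log_arg_ge0//.
apply: ler_wsqrtr; rewrite ler_wpM2l ?log_arg_ge0//.
case: k => [|k]; first by rewrite mulr0n mulr0 invr0.
rewrite lef_pV2 ?posrE ?mulr_gt0 ?ltr0n// ler_peMl ?ler0n// ler1n//.
Qed.

Lemma eps_le k : eps_t R T k <= log_rate.
Proof.
apply: le_trans (eps_le_rate k) _.
case: k => [|k]; first by rewrite mulr0n sqrtr0 invr0 mulr0 sqrtr_ge0.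
rewrite ler_piMr ?sqrtr_ge0// invf_le1 ?sqrtr_gt0 ?ltr0n//.
by rewrite -[leLHS]sqrtr1 ler_wsqrtr// ler1n.
Qed.

Definition average (f : nat -> R) k := k%:R^-1 * \sum_(j < k) f j.

Lemma average_bounds (f : nat -> R) k (V : R) : 0 <= V ->
  (forall j, 0 <= f j <= V) -> 0 <= average f k <= V.
Proof.
move=> V0 fV; rewrite /average.
case: k => [|k]; first by rewrite invr0 mul0r lexx V0.
have k0 : 0 < k.+1%:R :> R by rewrite ltr0n.
rewrite mulrC; apply/andP; split.
  by rewrite divr_ge0 ?ler0n//; apply: sumr_ge0 => j _; have /andP[] := fV j.
rewrite ler_pdivrMr//; apply: (@le_trans _ _ (\sum_(j < k.+1) V)).
  by apply: ler_sum => j _; have /andP[] := fV j.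
by rewrite sumr_const card_ord mulr_natr.
Qed.

Lemma rtil_bounds k :
  average (fun j => rwd (v k) (p j)) k <= rtil T p k (v k)
    <= average (fun j => rwd (v k) (p j)) k + eps_t R T k * vbar.
Proof.
rewrite /rtil -/(average (fun j => rwd (v k) (p j)) k) lerDl lerD2l.
have /andP[v0 vv] := v_bounds k.
by rewrite mulr_ge0 ?eps_ge0//= ler_wpM2l ?eps_ge0.
Qed.

Lemma ctil_bounds k :
  average (fun j => Defs.cst (v k) (p j)) k - 2 * eps_t R T k * vbar
    <= ctil T p k (v k) <= average (fun j => Defs.cst (v k) (p j)) k.
Proof.
rewrite /ctil -/(average (fun j => Defs.cst (v k) (p j)) k).
have /andP[v0 vv] := v_bounds k; have e0 := eps_ge0 k.
have := mulr_ge0 e0 v0; have := ler_wpM2l e0 vv; lra.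
Qed.

Lemma average_rwd_bounds k :
  0 <= average (fun j => rwd (v k) (p j)) k <= vbar.
Proof.
apply: average_bounds; first exact: ltW.
by move=> j; apply: rwd_bounds => //; have /andP[] := p_bounds j.
Qed.

Lemma average_cst_bounds k :
  0 <= average (fun j => Defs.cst (v k) (p j)) k <= vbar.
Proof.
by apply: average_bounds; [exact: ltW|move=> j; exact: cst_bounds].
Qed.

Lemma dual_grad_bounds k :
  - (vbar * (1 + 2 * log_rate)) <= dual_grad k <= vbar.
Proof.
have /andP[c1 c2] := ctil_bounds k; have /andP[c3 c4] := average_cst_bounds k.
have := ler_wpM2r (ltW vbar_gt0) (eps_le k).
have := mulr_ge0 log_rate_ge0 (ltW vbar_gt0).
move: vbar_gt0 rho_gt0 rho_le; rewrite /dual_grad.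
by case: (buys k); rewrite ?mul1r ?mul0r; lra.
Qed.

Definition multiplier_bound := vbar * (1 + log_rate) / rho + 1.

(* The multiplier only grows when the buyer buys at an estimated cost above
   [rho], which forces [multiplier k <= rtil / rho]. *)
Lemma multiplier_le n : multiplier n <= multiplier_bound.
Proof.
have B0 : 0 <= vbar * (1 + log_rate) / rho.
  by rewrite divr_ge0 ?mulr_ge0 ?addr_ge0 ?sqrtr_ge0// ltW.
elim: n => [|n IH]; first by rewrite /multiplier_bound /multiplier /= addr_ge0.
have [sn|sn] := boolP (stopped n); first by rewrite /multiplier run_stopped.
have [-> _ _ _] := run_step sn.
rewrite ge_max; apply/andP; split; last by rewrite /multiplier_bound addr_ge0.
have [g0|g0] := leP (dual_grad n) 0.
  apply: le_trans IH; rewrite gerDl; apply: mulr_ge0_le0 => //.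
  exact/ltW/eta_gt0.
have /andP[_ gv] := dual_grad_bounds n.
(* The summand [1] pays for the step itself, as [eta_t vbar n * vbar] is the inverse of the square
   root of [n.+1]; the other summand bounds the multiplier before the step. *)
apply: lerD; last first.
  apply: (@le_trans _ _ (eta_t vbar n * vbar)).
    by rewrite ler_wpM2l// ltW// eta_gt0.
  rewrite /eta_t invfM mulrAC mulVf ?gt_eqF// mul1r.
  by rewrite invf_le1 ?sqrtr_gt0 ?ltr0n// -[leLHS]sqrtr1 ler_wsqrtr// ler1n.
move: g0; rewrite /dual_grad; case: (boolP (buys n)) => [|_]; last first.
  by rewrite mul0r sub0r oppr_gt0 => /(lt_trans rho_gt0); rewrite ltxx.
rewrite /buys mul1r subr_gt0 => bn cn.
rewrite ler_pdivlMr//.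
have /andP[_ r2] := rtil_bounds n; have /andP[r3 r4] := average_rwd_bounds n.
apply: (@le_trans _ _ (multiplier n * ctil T p n (v n))).
  by rewrite ler_wpM2l ?multiplier_ge0// ltW.
apply: le_trans bn _; apply: le_trans r2 _.
by rewrite mulrDr mulr1 lerD// mulrC ler_wpM2l ?eps_le// ltW.
Qed.

(** The usual shape for decreasing steps: squared diameter over twice a step size, here
    [eta_t vbar T], plus half the squared gradient bound times the sum of the steps. *)
Definition regret_bound :=
  vbar * Num.sqrt T.+1%:R / 2 * multiplier_bound ^+ 2
  + (vbar * (1 + 2 * log_rate)) ^+ 2 / 2 * \sum_(k < T) eta_t vbar k.

(* Telescoping the distance of the multiplier to the comparator [mu]. *)
Lemma dual_regret_aux (mu : R) n : 0 <= mu <= 1 ->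
  \sum_(k < n) active k * (mu - multiplier k) * dual_grad k <=
  vbar * Num.sqrt n.+1%:R / 2 *
    (multiplier_bound ^+ 2 - (multiplier n - mu) ^+ 2)
  + (vbar * (1 + 2 * log_rate)) ^+ 2 / 2 * \sum_(k < n) eta_t vbar k.
Proof.
move=> /andP[mu0 mu1].
have B1 : 1 <= multiplier_bound.
  rewrite /multiplier_bound lerDr divr_ge0 ?mulr_ge0 ?addr_ge0 ?sqrtr_ge0//;
  exact: ltW.
(* This sign is what allows the coefficient to grow with the inverse step size from one round to the
   next. *)
have dist k : 0 <= multiplier_bound ^+ 2 - (multiplier k - mu) ^+ 2.
  have l0 := multiplier_ge0 k; have l1 := multiplier_le k.
  by rewrite subr_sqr mulr_ge0//; lra.
elim: n => [|n IH].
  rewrite !big_ord0 mulr0 addr0 mulr_ge0// divr_ge0// mulr_ge0 ?sqrtr_ge0//.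
  exact: ltW.
rewrite !big_ord_recr /=.
set G := (vbar * (1 + 2 * log_rate)) ^+ 2 / 2 in IH *; rewrite (mulrDr G).
have eta0 := eta_gt0 n.
have G0 : 0 <= G by rewrite divr_ge0 ?sqr_ge0.
have sqrt_mono : Num.sqrt n.+1%:R <= Num.sqrt n.+2%:R :> R.
  by rewrite ler_wsqrtr// ler_nat.
have step : active n * (mu - multiplier n) * dual_grad n <=
    vbar * Num.sqrt n.+1%:R / 2 *
      ((multiplier n - mu) ^+ 2 - (multiplier n.+1 - mu) ^+ 2)
    + G * eta_t vbar n.
  rewrite /active; have [sn|sn] := boolP (stopped n).
    rewrite !mul0r /multiplier run_stopped// subrr mulr0 add0r.
    by rewrite mulr_ge0// ltW.
  have [-> _ _ _] := run_step sn; rewrite mul1r.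
  set l := multiplier n; set g := dual_grad n; set e := eta_t vbar n in eta0 *.
  have ei : vbar * Num.sqrt n.+1%:R = e^-1 by rewrite /e /eta_t invrK.
  (* Projecting onto the nonnegative reals brings a point no further from [mu >= 0]. *)
  have proj : (Num.max (l + e * g) 0 - mu) ^+ 2 <= (l + e * g - mu) ^+ 2.
    by rewrite /Num.max; case: ifP => // /ltW lt0; nra.
  have gG : g ^+ 2 / 2 <= G.
    have /andP[g1 g2] := dual_grad_bounds n; rewrite -/g in g1 g2.
    have vA : vbar <= vbar * (1 + 2 * log_rate).
      by rewrite (ler_peMr (ltW vbar_gt0))// lerDl mulr_ge0// log_rate_ge0.
    by rewrite /G ler_pM2r ?invr_gt0// -subr_ge0 subr_sqr mulr_ge0//; lra.
  rewrite ei.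
  have expand : (mu - l) * g = e^-1 / 2 * ((l - mu) ^+ 2 - (l + e * g - mu) ^+ 2)
      + g ^+ 2 / 2 * e.
    by field; rewrite gt_eqF.
  rewrite expand; apply: lerD; last by rewrite ler_wpM2r// ltW.
  apply: ler_wpM2l; last by rewrite lerD2l lerN2.
  by rewrite divr_ge0// invr_ge0 ltW.
apply: le_trans (lerD IH step) _.
have : vbar * Num.sqrt n.+1%:R / 2 <= vbar * Num.sqrt n.+2%:R / 2.
  by rewrite ler_pM2r ?invr_gt0// ler_wpM2l// ltW.
move=> /(ler_wpM2r (dist n.+1)); lra.
Qed.

Lemma dual_regret (mu : R) : 0 <= mu <= 1 ->
  \sum_(k < T) active k * (mu - multiplier k) * dual_grad k <= regret_bound.
Proof.
move=> mu01; apply: le_trans (dual_regret_aux T mu01) _.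
rewrite /regret_bound lerD2r ler_wpM2l//; last by rewrite gerBl sqr_ge0.
by rewrite divr_ge0 ?mulr_ge0 ?sqrtr_ge0// ltW.
Qed.

(** * Revenue against the randomised comparator on one sample path *)

Lemma active01 k : active k = 0 \/ active k = 1.
Proof. by rewrite /active; case: stopped; [left|right]. Qed.

Variables rbar cbar : nat -> R.
Local Notation r k := (rwd (v k) (p k)).
Local Notation c k := (Defs.cst (v k) (p k)).
Local Notation dr k := `|average (fun j => rwd (v k) (p j)) k - rbar k|.
Local Notation dc k :=
  `|average (fun j => Defs.cst (v k) (p j)) k - cbar k|.
Local Notation alpha := (rho / vbar).

(* Buying with probability [alpha] in every round costs at most [rho] on average
   and earns [alpha * r k]; the Lagrangian choice of [buys] does no worse. *)
Lemma round_bound (mu : R) k : mu = 1 \/ (mu = 0 /\ active k = 1) ->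
  alpha * r k + bought k * (r k - rbar k) - alpha * (active k * (r k - rbar k))
    - active k * (mu - multiplier k) * dual_grad k
    + mu * (bought k * c k - bought k * (c k - cbar k) - rho)
    - (2 * dr k + dc k + 3 * eps_t R T k * vbar)
  <= bought k * r k.
Proof.
have a0 : 0 <= alpha by rewrite divr_ge0// ltW.
have a1 : alpha <= 1 by rewrite ler_pdivrMr// mul1r.
have av : alpha * vbar = rho by rewrite divfK// gt_eqF.
move: alpha a0 a1 av => al a0 a1 av.
have /andP[r1 r2] : 0 <= r k <= vbar.
  by apply: rwd_bounds => //; have /andP[] := p_bounds k.
have ar : al * r k <= rho by rewrite -av ler_wpM2l.
have e0 : 0 <= eps_t R T k * vbar by rewrite mulr_ge0 ?eps_ge0// ltW.
have dr0 : 0 <= dr k by []. 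
have dc0 : 0 <= dc k by [].
have /andP[rt1 rt2] := rtil_bounds k; have /andP[ct1 ct2] := ctil_bounds k.
have /andP[ah0 ah1] := average_cst_bounds k.
have l0 := multiplier_ge0 k.
have /ler_normlP[d1 d2] : `|average (fun j => rwd (v k) (p j)) k - rbar k| <= dr k.
  by [].
have /ler_normlP[d3 d4] :
    `|average (fun j => Defs.cst (v k) (p j)) k - cbar k| <= dc k.
  by [].
set rt := rtil T p k (v k) in rt1 rt2 *; set ct := ctil T p k (v k) in ct1 ct2 *.
set rh := average (fun j => rwd _ _) k in rt1 rt2 d1 d2 *.
set ch := average (fun j => Defs.cst _ _) k in ct1 ct2 d3 d4 ah0 ah1 *.
set l := multiplier k in l0 *.
have lagr : al * rt + l * dual_grad k <= (buys k)%:R * rt.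
  have lc : l * (al * ct) <= l * rho.
    by rewrite ler_wpM2l// -av ler_wpM2l// (le_trans ct2).
  rewrite /dual_grad /buys -/rt -/ct -/l; case: (leP (l * ct) rt) => h /=.
    have : al * (rt - l * ct) <= rt - l * ct by rewrite ler_piMl// subr_ge0.
    lra.
  have : al * (rt - l * ct) <= 0.
    by apply: mulr_ge0_le0 => //; rewrite subr_le0 ltW.
  lra.
have alr : al * (r k - rt) <= al * (r k - rbar k) + dr k.
  have : al * (rbar k - rt) <= dr k.
    apply: (@le_trans _ _ (al * dr k)); last by rewrite ler_piMl.
    by rewrite ler_wpM2l//; lra.
  lra.
rewrite /bought; case: (active01 k) => ak; rewrite ak; last first.
  have gE : dual_grad k = (buys k)%:R * ct - rho by [].
  move=> [->|[-> _]]; move: lagr gE; rewrite !mul1r;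
    case: (buys k) => /=; rewrite ?mul1r ?mul0r => lagr gE;
    rewrite ?gE; move: lagr; rewrite ?gE; lra.
(* After the stop nothing is earned, but then [mu = 1], and its term [- rho] absorbs the
   comparator's gain [alpha * r k <= rho]. *)
move=> [->|[_ /eqP]]; last by rewrite eq_sym oner_eq0.
lra.
Qed.

(** Sum of [round_bound] over the rounds, with [dual_regret] for the gradient terms. Here [rbar] and
    [cbar] are arbitrary; once they are the true means, the three absolute values are those of
    martingales. *)
Lemma revenue_bound :
  alpha * \sum_(k < T) r k
  - (vbar + regret_bound
     + `|\sum_(k < T) bought k * (r k - rbar k)|
     + `|\sum_(k < T) active k * (r k - rbar k)|
     + `|\sum_(k < T) bought k * (c k - cbar k)|
     + \sum_(k < T) (2 * dr k + dc k + 3 * eps_t R T k * vbar))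
  <= revenue T.
Proof.
have a0 : 0 <= alpha by rewrite divr_ge0// ltW.
have a1 : alpha <= 1 by rewrite ler_pdivrMr// mul1r.
have [mu [mu01 hmu hend]] : exists mu, [/\ 0 <= mu <= 1,
    forall k : 'I_T, mu = 1 \/ (mu = 0 /\ active k = 1)
    & mu * (rho * T%:R - vbar - \sum_(k < T) bought k * c k) <= 0].
  have [sT|sT] := boolP (stopped T).
    exists 1; split; [by rewrite ler01 lexx|by left|].
    by have := stopped_budget sT; rewrite budgetE mul1r; lra.
  exists 0; split; [by rewrite ler01 lexx| |by rewrite mul0r].
  move=> k; right; split=> //; rewrite /active.
  by rewrite (contra (stopped_mono (ltnW (ltn_ord k))) sT).
have := dual_regret mu01.
have := @ler_sum _ _ (index_enum 'I_T) xpredT _ _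
  (fun (k : 'I_T) _ => round_bound (hmu k)).
rewrite -revenueE sumrB big_split /= sumrB sumrB big_split /= -!mulr_sumr.
rewrite !sumrB sumr_const card_ord -(mulr_natr rho).
set S1 := \sum_(k < T) bought k * (r k - rbar k).
set S2 := \sum_(k < T) active k * (r k - rbar k).
set S3 := \sum_(k < T) bought k * (c k - cbar k).
set Sc := \sum_(k < T) bought k * c k in hend *.
set Sr := \sum_(k < T) r k; set Se := \sum_(k < T) (_ + _).
set Sg := \sum_(k < T) _.
have h1 : - `|S1| <= S1 by rewrite lerNl -normrN ler_norm.
have h2 : alpha * S2 <= `|S2|.
  apply: le_trans (ler_norm _) _.
  by rewrite normrM ger0_norm// ler_piMl.
have h3 : mu * S3 <= `|S3|.
  case/andP: mu01 => mu0 mu1; apply: le_trans (ler_norm _) _.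
  by rewrite normrM ger0_norm// ler_piMl.
have h4 : mu * vbar <= vbar.
  by case/andP: mu01 => mu0 mu1; rewrite ler_piMl// ltW.
move: hend; lra.
Qed.

End Run.

(** * Expected loss *)

Section Adapted.
Variables (R : realType) (vbar rho : R) (T : nat).

(** Serves both to make the martingale weights adapted and to alter the values beyond the
    horizon. *)
Lemma ogd_run_ext (v v' p q : nat -> R) n :
    (forall j, (j < n)%N -> v j = v' j /\ p j = q j) ->
  ogd_run vbar rho T v p n = ogd_run vbar rho T v' q n.
Proof.
elim: n => [//|n IH] E /=.
rewrite IH => [|j jn]; last exact/E/ltnW.
case: (ogd_run _ _ _ _ _ n) => [[[lam bud] stp] rev].
have [vn pn] := E n (ltnSn n).
have rE : rtil T p n (v n) = rtil T q n (v' n).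
  rewrite /rtil vn; congr (_ * _ + _); apply: eq_bigr => j _.
  by have [_ ->] := E j (ltnW (ltn_ord j)).
have cE : ctil T p n (v n) = ctil T q n (v' n).
  rewrite /ctil vn; congr (_ * _ - _); apply: eq_bigr => j _.
  by have [_ ->] := E j (ltnW (ltn_ord j)).
by rewrite /ogd_step rE cE vn pn.
Qed.

Variable v : nat -> R.

Lemma active_adapted p q k : (forall j, (j < k)%N -> p j = q j) ->
  active vbar rho T v p k = active vbar rho T v q k.
Proof.
by move=> E; rewrite /active /stopped (@ogd_run_ext v v p q)// => j /E.
Qed.

(** The decision of round [k] sees the prices only through the state and the averages over earlier
    rounds, never through [p k]. *)
Lemma bought_adapted p q k : (forall j, (j < k)%N -> p j = q j) ->
  bought vbar rho T v p k = bought vbar rho T v q k.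
Proof.
move=> E; rewrite /bought (active_adapted E); congr (_ * (nat_of_bool _)%:R).
rewrite /buys /multiplier (@ogd_run_ext v v p q); last by move=> j /E.
congr (_ * _ <= _).
  rewrite /ctil; congr (_ * _ - _); apply: eq_bigr => j _.
  by rewrite E.
by rewrite /rtil; congr (_ * _ + _); apply: eq_bigr => j _; rewrite E.
Qed.

Lemma active_sqr_le1 p k : active vbar rho T v p k ^+ 2 <= 1.
Proof. by rewrite /active; case: stopped; rewrite /= ?expr0n ?expr1n. Qed.

Lemma bought_sqr_le1 p k : bought vbar rho T v p k ^+ 2 <= 1.
Proof.
rewrite /bought exprMn -[leRHS]mulr1 ler_pM ?sqr_ge0 ?active_sqr_le1//.
by case: buys; rewrite /= ?expr0n ?expr1n.
Qed.

End Adapted.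

(** * Elementary bounds on the hindsight benchmark *)

Section Hindsight.
Variables (R : realType) (rho : R) (T : nat) (v p : nat -> R).

Lemma rwd_ge0 (x y : R) : 0 <= rwd x y.
Proof. by rewrite /rwd le_max lexx orbT. Qed.

Lemma hindsight_ge0 : 0 <= hindsight rho T v p.
Proof.
rewrite /hindsight; elim/big_ind: _ => // [x y x0 y0|x _].
  by rewrite le_max x0.
by apply: sumr_ge0 => k _; case: ifP => // _; exact: rwd_ge0.
Qed.

Lemma hindsight_le : hindsight rho T v p <= \sum_(k < T) rwd (v k) (p k).
Proof.
rewrite /hindsight; elim/big_ind: _ => [|x y hx hy|x _].
- by apply: sumr_ge0 => k _; exact: rwd_ge0.
- by rewrite ge_max hx.
- by apply: ler_sum => k _; case: ifP => // _; exact: rwd_ge0.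
Qed.

End Hindsight.

(** * Sums of inverse square roots, and growth of the logarithm *)

Section Rates.
Variable R : realType.

Lemma sum_invsqrtS_le n :
  \sum_(k < n) (Num.sqrt k.+1%:R)^-1 <= 2 * Num.sqrt n%:R :> R.
Proof.
elim: n => [|n IH]; first by rewrite big_ord0 mulr_ge0// sqrtr_ge0.
rewrite big_ord_recr /=; apply: le_trans (lerD IH (lexx _)) _.
set a := Num.sqrt n%:R; set b := Num.sqrt n.+1%:R.
have b0 : 0 < b by rewrite sqrtr_gt0 ltr0n.
have ab : b ^+ 2 = a ^+ 2 + 1 by rewrite !sqr_sqrtr ?ler0n// natr1.
(* What remains is [1 <= (2 * b - 2 * a) * b]; as [b ^+ 2 - a ^+ 2 = 1], the difference of the two
   sides is [(b - a) ^+ 2]. *)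
rewrite -lerBrDl -(ler_pM2r b0) mulVf ?gt_eqF//.
have : 0 <= (b - a) ^+ 2 by exact: sqr_ge0.
rewrite -subr_ge0 => h; suff -> : (2 * b - 2 * a) * b - 1 = (b - a) ^+ 2 by lra.
have -> : (2 * b - 2 * a) * b = 2 * b ^+ 2 - 2 * (a * b) by ring.
have -> : (b - a) ^+ 2 = b ^+ 2 + a ^+ 2 - 2 * (a * b) by ring.
rewrite ab; ring.
Qed.

Lemma sum_invsqrt_le n :
  \sum_(k < n) (Num.sqrt k%:R)^-1 <= 2 * Num.sqrt n%:R :> R.
Proof.
case: n => [|n]; first by rewrite big_ord0 mulr_ge0// sqrtr_ge0.
rewrite big_ord_recl /= mulr0n sqrtr0 invr0 add0r.
apply: le_trans (sum_invsqrtS_le n) _.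
by rewrite ler_wpM2l// ler_wsqrtr// ler_nat.
Qed.

(** Trades an absolute value for a square, so that second moments suffice; [a] is to be the typical
    size of [x]. *)
Lemma amgm_abs (a x : R) : 0 < a -> `|x| <= (2 * a)^-1 * x ^+ 2 + a / 2.
Proof.
move=> a0; have h : 0 <= (`|x| - a) ^+ 2 by exact: sqr_ge0.
rewrite -(real_normK (num_real x)).
have -> : (2 * a)^-1 * `|x| ^+ 2 + a / 2 = `|x| + (2 * a)^-1 * (`|x| - a) ^+ 2.
  by field; rewrite gt_eqF.
by rewrite lerDl mulr_ge0// invr_ge0 mulr_ge0// ltW.
Qed.

(** With [u] the fourth root, the logarithm is [4 * ln u], and [ln u <= u - 1]. *)
Lemma ln_le_fourth_root (T : nat) : (0 < T)%N ->
  ln T%:R <= 4 * Num.sqrt (Num.sqrt T%:R) :> R.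
Proof.
move=> T0; set u := Num.sqrt (Num.sqrt T%:R).
have u0 : 0 < u by rewrite !sqrtr_gt0 ltr0n.
have -> : T%:R = u ^+ 4 :> R.
  by rewrite (exprM u 2 2) sqr_sqrtr ?sqrtr_ge0// sqr_sqrtr// ler0n.
rewrite lnXn// -[leLHS]mulr_natl ler_wpM2l//.
have := @le_ln1Dx R (u - 1); rewrite addrCA subrr addr0 => h.
by apply: le_trans (h _) _; rewrite ?gerBl//; lra.
Qed.

End Rates.

(** * Measurability of reward and cost in the price *)

Section Measurability.
Variables (R : realType) (D : set R).
Hypothesis mD : measurable D.

Lemma measurable_rwd v : measurable_fun D (rwd v : R -> R).
Proof.
apply: measurable_maxr; last exact: measurable_cst.
apply: measurable_funB => //; exact: measurable_cst.
Qed.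

Lemma measurable_cost v : measurable_fun D (Defs.cst v : R -> R).
Proof.
apply: measurable_fun_if => //.
exact: (@measurable_fun_ler _ _ _ D id (fun=> v)).
Qed.

End Measurability.

(** * The potential and the expected revenue *)

Section ExpectedRevenue.
Variables (R : realType) (vbar rho : R) (T : nat) (v : nat -> R).
Hypotheses (vbar_gt0 : 0 < vbar) (rho_gt0 : 0 < rho) (rho_le : rho <= vbar).
Hypothesis T_gt0 : (0 < T)%N.
Hypothesis v_bounds : forall t, 0 <= v t <= vbar.
Variable G : probability R R.
Let D : set R := `[0, vbar].
Hypothesis GD : G D = 1%E.

Lemma measurable_support : measurable D.
Proof. exact: measurable_itv. Qed.

Lemma supportP x : D x -> 0 <= x <= vbar.
Proof. by rewrite /D /= in_itv. Qed.

Lemma rwd_support k x : D x -> 0 <= rwd (v k) x <= vbar.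
Proof. by move=> /supportP/andP[x0 _]; exact: rwd_bounds. Qed.

Lemma cst_support k x : D x -> 0 <= Defs.cst (v k) x <= vbar.
Proof. by move=> /supportP; exact: cst_bounds. Qed.

(** Freezes a martingale after [k] draws, so that the estimation error of each round becomes a
    martingale over the whole horizon. *)
Definition prefix_weight k (_ : nat -> R) (j : nat) : R := (j < k)%:R.

Lemma prefix_martingale f k (p : nat -> R) : (k <= T)%N ->
  martingale G D (fun=> f) (prefix_weight k) p T =
  \sum_(j < k) (f (p j) - Rintegral G D f).
Proof.
move=> kT; rewrite (big_ord_widen T (fun j => f (p j) - _) kT) big_mkcond /=.
apply: eq_bigr => j _; rewrite /prefix_weight.
by case: ifP => _; rewrite ?mul1r ?mul0r.
Qed.

(** The factor of the square in [amgm_abs] at the scale [Num.sqrt k%:R * vbar] of a sum of [k]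
    centred terms, divided by [k] to pass to the average. *)
Definition prefix_coeff k : R := k%:R^-1 * (2 * (Num.sqrt k%:R * vbar))^-1.

Lemma prefix_coeff_ge0 k : 0 <= prefix_coeff k.
Proof.
by rewrite mulr_ge0 ?invr_ge0 ?ler0n// mulr_ge0// mulr_ge0 ?sqrtr_ge0// ltW.
Qed.

Lemma prefix_coeff_sqr k :
  prefix_coeff k * (vbar ^+ 2 * k%:R) = vbar / 2 * (Num.sqrt k%:R)^-1.
Proof.
rewrite /prefix_coeff; case: k => [|k]; first by rewrite mulr0n sqrtr0 invr0 !mulr0.
have k0 : 0 < k.+1%:R :> R by rewrite ltr0n.
have s0 : 0 < Num.sqrt k.+1%:R :> R by rewrite sqrtr_gt0.
by field; rewrite !gt_eqF.
Qed.

(** [amgm_abs] applied to the centred sum. For [k = 0] the average is [0] by convention and the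
    error is [m] itself, which the last term covers. *)
Lemma average_dist_le (f : R -> R) (p : nat -> R) m k : 0 <= m <= vbar ->
  `|average (fun j => f (p j)) k - m| <=
  prefix_coeff k * (\sum_(j < k) (f (p j) - m)) ^+ 2
  + vbar / 2 * (Num.sqrt k%:R)^-1 + vbar * (k == 0%N)%:R.
Proof.
move=> /andP[m0 mV]; rewrite /average /prefix_coeff.
case: k => [|k].
  rewrite mulr0n sqrtr0 invr0 !mul0r !mulr0 !add0r normrN ger0_norm//.
  by rewrite mulr1.
rewrite mulr0 addr0.
have k0 : 0 < k.+1%:R :> R by rewrite ltr0n.
have s0 : 0 < Num.sqrt k.+1%:R :> R by rewrite sqrtr_gt0.
set S := \sum_(j < k.+1) (f (p j) - m).
have -> : k.+1%:R^-1 * (\sum_(j < k.+1) f (p j)) - m = k.+1%:R^-1 * S.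
  rewrite /S sumrB sumr_const card_ord mulrBr -[m *+ _]mulr_natl.
  by rewrite mulKf// gt_eqF.
rewrite normrM ger0_norm ?invr_ge0 ?ler0n//.
have a0 : 0 < Num.sqrt k.+1%:R * vbar by exact: mulr_gt0.
apply: (@le_trans _ _ (k.+1%:R^-1 * ((2 * (Num.sqrt k.+1%:R * vbar))^-1 * S ^+ 2
    + Num.sqrt k.+1%:R * vbar / 2))).
  by rewrite ler_wpM2l ?invr_ge0 ?ler0n// amgm_abs.
rewrite mulrDr mulrA lerD2l -{1}(sqr_sqrtr (ltW k0)).
set s := Num.sqrt _ in s0 *.
suff -> : (s ^+ 2)^-1 * (s * vbar / 2) = vbar / 2 * s^-1 by [].
by field; rewrite gt_eqF.
Qed.

Definition trading_potential (s : seq R) : R :=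
  square_potential G D vbar (fun k => rwd (v k))
    (bought vbar rho T v) T (fun=> 1) s
  + square_potential G D vbar (fun k => rwd (v k))
    (active vbar rho T v) T (fun=> 1) s
  + square_potential G D vbar (fun k => Defs.cst (v k))
    (bought vbar rho T v) T (fun=> 1) s.

(** The factors [2] and [1] repeat those of the reward and cost errors in [round_bound]. *)
Definition estimation_potential k (s : seq R) : R :=
  2 * square_potential G D vbar (fun=> rwd (v k)) (prefix_weight k) T
        (fun j => (j < k)%:R) s
  + square_potential G D vbar (fun=> Defs.cst (v k)) (prefix_weight k) T
      (fun j => (j < k)%:R) s.

(** On a full history it dominates, up to deterministic terms, the random errors in [revenue_bound];
    on the empty history it is explicit. *)
Definition potential s :=
  (2 * (Num.sqrt T%:R * vbar))^-1 * trading_potential s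
  + \sum_(k < T) prefix_coeff k * estimation_potential k s.

Let mr k : measurable_fun D (rwd (v k)).
Proof. exact: measurable_rwd. Qed.

Let mc k : measurable_fun D (Defs.cst (v k)).
Proof. by apply: measurable_cost; exact: measurable_support. Qed.

Lemma prefix_weight_sqr k (p : nat -> R) j :
  prefix_weight k p j ^+ 2 <= (j < k)%:R.
Proof. by rewrite /prefix_weight; case: ltnP; rewrite /= ?expr0n ?expr1n. Qed.

Lemma potential_ge0 s : 0 <= potential s.
Proof.
rewrite addr_ge0//.
  apply: mulr_ge0; first by rewrite invr_ge0 !mulr_ge0 ?sqrtr_ge0// ltW.
  apply: addr_ge0; [apply: addr_ge0|]; apply: square_potential_ge0.
  - exact: bought_sqr_le1.
  - exact: active_sqr_le1.
  - exact: bought_sqr_le1.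
apply: sumr_ge0 => k _; rewrite mulr_ge0 ?prefix_coeff_ge0//.
apply: addr_ge0; first apply: mulr_ge0 => //;
  by apply: square_potential_ge0; exact: prefix_weight_sqr.
Qed.

Lemma potential_supermartingale : supermartingale G D T potential.
Proof.
have mD := measurable_support.
apply: supermartingaleD => //.
  apply: supermartingaleZ => //.
    by rewrite invr_ge0 !mulr_ge0 ?sqrtr_ge0// ltW.
  apply: supermartingaleD => //; first apply: supermartingaleD => //.
  - apply: square_potential_supermartingale => //.
    + by move=> k x; exact: rwd_support.
    + exact: bought_adapted.
    + exact: bought_sqr_le1.
  - apply: square_potential_supermartingale => //.
    + by move=> k x; exact: rwd_support.
    + exact: active_adapted.
    + exact: active_sqr_le1.
  - apply: square_potential_supermartingale => //.
    + by move=> k x; exact: cst_support.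
    + exact: bought_adapted.
    + exact: bought_sqr_le1.
apply: supermartingale_sum => // k; apply: supermartingaleZ => //.
  exact: prefix_coeff_ge0.
apply: supermartingaleD => //; first apply: supermartingaleZ => //.
- apply: square_potential_supermartingale => //.
  + by move=> _ x; exact: rwd_support.
  + exact: prefix_weight_sqr.
- apply: square_potential_supermartingale => //.
  + by move=> _ x; exact: cst_support.
  + exact: prefix_weight_sqr.
Qed.

Lemma square_potential_nil h w b :
  square_potential G D vbar h w T b [::] = vbar ^+ 2 * \sum_(j < T) b j.
Proof.
by rewrite /square_potential /martingale big_ord0 expr0n add0r big_mkord.
Qed.

Lemma square_potential_full h w b s : size s = T ->
  square_potential G D vbar h w T b s =
  martingale G D h w (fun t => nth 0 s t) T ^+ 2.
Proof. by move=> sT; rewrite /square_potential sT big_geq// mulr0 addr0. Qed.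

Lemma potential_nil :
  potential [::] = 3 / 2 * (vbar * Num.sqrt T%:R)
    + \sum_(k < T) 3 / 2 * (vbar * (Num.sqrt k%:R)^-1).
Proof.
rewrite /potential /trading_potential !square_potential_nil sumr_const card_ord.
have T0 : 0 < T%:R :> R by rewrite ltr0n.
have s0 : 0 < Num.sqrt T%:R :> R by rewrite sqrtr_gt0.
congr (_ + _).
  rewrite -{2 3 4}(sqr_sqrtr (ltW T0)); set s := Num.sqrt _ in s0 *.
  by field; rewrite !gt_eqF.
apply: eq_bigr => k _; rewrite /estimation_potential !square_potential_nil.
have -> : \sum_(j < T) (j < k)%:R = k%:R :> R.
  transitivity (\sum_(j < k) (1 : R)); last by rewrite sumr_const card_ord.
  rewrite (big_ord_widen T (fun=> 1) (ltnW (ltn_ord k))) [RHS]big_mkcond.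
  by apply: eq_bigr => j _; case: ltnP.
transitivity (3 * (prefix_coeff k * (vbar ^+ 2 * k%:R))); first by ring.
by rewrite prefix_coeff_sqr; ring.
Qed.

(** In the two terms with square roots of [T] and [k], the [3] is [3 / 2] from the constants of
    [amgm_abs] plus [3 / 2] from the initial potential. *)
Definition expected_loss : R :=
  vbar + regret_bound vbar rho T + 3 * (vbar * Num.sqrt T%:R)
  + \sum_(k < T) (3 * (vbar * (Num.sqrt k%:R)^-1) + 3 * (vbar * ((k : nat) == 0%N)%:R)
                  + 3 * eps_t R T k * vbar).

Lemma expected_revenue_bound :
  - expected_loss <= Eprod G T (fun s =>
      ogdcb_revenue vbar rho T v (fun t => nth 0 s t)
      - rho / vbar * hindsight rho T v (fun t => nth 0 s t)).
Proof.
have mD := measurable_support.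
have T0 : 0 < T%:R :> R by rewrite ltr0n.
have s0 : 0 < Num.sqrt T%:R :> R by rewrite sqrtr_gt0.
have sV0 : 0 < Num.sqrt T%:R * vbar by exact: mulr_gt0.
have al0 : 0 <= rho / vbar by rewrite divr_ge0// ltW.
have Reg0 : 0 <= regret_bound vbar rho T.
  rewrite /regret_bound addr_ge0// mulr_ge0//.
  - by rewrite divr_ge0 ?mulr_ge0 ?sqrtr_ge0// ltW.
  - exact: sqr_ge0.
  - by rewrite divr_ge0// sqr_ge0.
  - by apply: sumr_ge0 => k _; exact/ltW/eta_gt0.
(* The deterministic part of the pathwise bound; the potential accounts for the rest. *)
pose c := - (vbar + regret_bound vbar rho T + 3 / 2 * (vbar * Num.sqrt T%:R)
  + \sum_(k < T) (3 / 2 * (vbar * (Num.sqrt k%:R)^-1)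
       + 3 * (vbar * ((k : nat) == 0%N)%:R) + 3 * eps_t R T k * vbar)).
have -> : - expected_loss = c - potential [::].
  rewrite potential_nil /expected_loss /c.
  rewrite -!opprD; congr (- _).
  rewrite addrACA -big_split /=; congr (_ + _); first by field.
  by apply: eq_bigr => k _; lra.
have C0 : 0 <= T%:R * vbar by rewrite mulr_ge0 ?ler0n// ltW.
apply: (@Eprod_ge _ _ _ mD GD T potential _ c (T%:R * vbar)) => //.
- exact: potential_ge0.
- exact: potential_supermartingale.
- apply: le_trans C0; rewrite oppr_le0.
  have h1 : 0 <= vbar * Num.sqrt T%:R by rewrite mulr_ge0 ?sqrtr_ge0// ltW.
  apply: addr_ge0; first by move: vbar_gt0; lra.
  apply: sumr_ge0 => k _.
  have h2 : 0 <= vbar * (Num.sqrt k%:R)^-1.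
    by rewrite mulr_ge0 ?invr_ge0 ?sqrtr_ge0// ltW.
  have h3 : 0 <= vbar * ((k : nat) == 0%N)%:R by rewrite mulr_ge0 ?ler0n// ltW.
  have h4 : 0 <= eps_t R T k * vbar by rewrite mulr_ge0 ?sqrtr_ge0// ltW.
  lra.
move=> s sD sT; set p := fun t => nth 0 s t.
have p_bounds t : 0 <= p t <= vbar.
  (* Past the end of the history [nth] returns [0], which also lies in the interval. *)
  have [ts|ts] := ltnP t (size s); last by rewrite /p nth_default// lexx ltW.
  by apply: supportP; apply: sD; exact: mem_nth.
apply/andP; split; last first.
  rewrite lerBlDr; apply: (@le_trans _ _ (T%:R * vbar)); last first.
    by rewrite lerDl mulr_ge0// hindsight_ge0.
  have -> : ogdcb_revenue vbar rho T v p = revenue vbar rho T v p T by [].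
  rewrite revenueE//; apply: (@le_trans _ _ (\sum_(k < T) vbar)); last first.
    by rewrite sumr_const card_ord mulr_natl.
  apply: ler_sum => k _.
  have /andP[pk0 _] := p_bounds k.
  have /andP[r0 rV] := rwd_bounds (v_bounds k) pk0.
  rewrite /bought /active.
  by case: stopped; case: buys; rewrite /= ?mul0r ?mulr0 ?mul0r ?mul1r// ltW.
pose rb k := mean G D (fun k => rwd (v k)) k.
pose cb k := mean G D (fun k => Defs.cst (v k)) k.
have rb_bounds k : 0 <= rb k <= vbar.
  by apply: (mean_bounds mD GD mr); move=> j x; exact: rwd_support.
have cb_bounds k : 0 <= cb k <= vbar.
  by apply: (mean_bounds mD GD mc); move=> j x; exact: cst_support.
have := @revenue_bound _ _ _ T v p vbar_gt0 rho_gt0 rho_le v_bounds p_bounds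
  rb cb.
have := ler_wpM2l al0 (hindsight_le rho T v p).
rewrite -/(ogdcb_revenue vbar rho T v p).
have M1 := amgm_abs
  (martingale G D (fun k => rwd (v k))
    (bought vbar rho T v) p T) sV0.
have M2 := amgm_abs
  (martingale G D (fun k => rwd (v k))
    (active vbar rho T v) p T) sV0.
have M3 := amgm_abs
  (martingale G D (fun k => Defs.cst (v k))
    (bought vbar rho T v) p T) sV0.
have est : \sum_(k < T)
    (2 * `|average (fun j => rwd (v k) (p j)) k - rb k|
     + `|average (fun j => Defs.cst (v k) (p j)) k - cb k|
     + 3 * eps_t R T k * vbar)
  <= \sum_(k < T) prefix_coeff k * estimation_potential k s
     + \sum_(k < T) (3 / 2 * (vbar * (Num.sqrt k%:R)^-1)
         + 3 * (vbar * ((k : nat) == 0%N)%:R) + 3 * eps_t R T k * vbar).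
  rewrite -big_split /=; apply: ler_sum => k _.
  have h1 := average_dist_le (rwd (v k)) p k (rb_bounds k).
  have h2 := average_dist_le (Defs.cst (v k)) p k (cb_bounds k).
  rewrite /estimation_potential !square_potential_full//.
  rewrite !prefix_martingale ?(ltnW (ltn_ord k))//.
  rewrite -/(rb k) -/(cb k); lra.
rewrite /potential /trading_potential !square_potential_full// -/p /c.
move: est M1 M2 M3; rewrite /martingale -/(rb _) -/(cb _).
lra.
Qed.

End ExpectedRevenue.

(** * Growth of the expected loss in the horizon *)

Section LossRate.
Variables (R : realType) (vbar rho : R).
Hypotheses (vbar_gt0 : 0 < vbar) (rho_gt0 : 0 < rho).

(** The square and [4] come from the two terms of the regret, and the remaining [19] from all other
    losses. *)
Definition loss_factor : R := vbar * ((vbar / rho + 1) ^+ 2 + 23).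

Lemma sum_eta_le T : \sum_(k < T) eta_t vbar k <= vbar^-1 * (2 * Num.sqrt T%:R).
Proof.
under eq_bigr do rewrite /eta_t invfM.
by rewrite -mulr_sumr ler_wpM2l ?sum_invsqrtS_le// invr_ge0 ltW.
Qed.

Lemma regret_bound_le T : (0 < T)%N ->
  regret_bound vbar rho T <=
  vbar * ((vbar / rho + 1) ^+ 2 + 4) * ((1 + log_rate R T) ^+ 2 * Num.sqrt T%:R).
Proof.
move=> T0; rewrite /regret_bound /multiplier_bound.
have K0 := log_rate_ge0 R T; set K := log_rate R T in K0 *.
have q0 : 0 < vbar / rho by rewrite divr_gt0.
have sq : Num.sqrt T.+1%:R <= 2 * Num.sqrt T%:R :> R.
  rewrite -(ler_pXn2r (n := 2))// ?nnegrE ?sqrtr_ge0// ?mulr_ge0 ?sqrtr_ge0//.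
  rewrite exprMn !sqr_sqrtr ?ler0n// -natrX -natrM ler_nat.
  apply: (@leq_trans (T + T)); first by rewrite -addn1 leq_add2l.
  by rewrite addnn -mul2n leq_mul2r orbT.
set s := Num.sqrt T%:R in sq *; have s0 : 0 <= s by exact: sqrtr_ge0.
set q := vbar / rho in q0 *.
have B1 : vbar * (1 + K) / rho + 1 <= (q + 1) * (1 + K).
  by rewrite mulrAC -/q; lra.
have B0 : 0 <= vbar * (1 + K) / rho + 1.
  by rewrite mulrAC -/q addr_ge0// mulr_ge0 ?ltW//; lra.
have Bsq : (vbar * (1 + K) / rho + 1) ^+ 2 <= ((q + 1) * (1 + K)) ^+ 2.
  by rewrite ler_sqr// nnegrE (le_trans B0).
have h1 : vbar * Num.sqrt T.+1%:R / 2 * (vbar * (1 + K) / rho + 1) ^+ 2 <=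
    vbar * s * ((q + 1) * (1 + K)) ^+ 2.
  apply: ler_pM => //.
  - by rewrite divr_ge0// mulr_ge0 ?sqrtr_ge0// ltW.
  - exact: sqr_ge0.
  - by rewrite ler_pdivrMr// -mulrA ler_wpM2l ?(ltW vbar_gt0)// mulrC.
have h2 : (vbar * (1 + 2 * K)) ^+ 2 / 2 * \sum_(k < T) eta_t vbar k <=
    (vbar * (2 * (1 + K))) ^+ 2 / 2 * (vbar^-1 * (2 * s)).
  apply: ler_pM.
  - by rewrite divr_ge0// sqr_ge0.
  - by apply: sumr_ge0 => k _; exact/ltW/eta_gt0.
  - rewrite ler_pM2r ?invr_gt0// ler_sqr ?nnegrE ?mulr_ge0 ?(ltW vbar_gt0)//;
      try lra.
    by rewrite ler_wpM2l ?(ltW vbar_gt0)//; lra.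
  - exact: sum_eta_le.
apply: le_trans (lerD h1 h2) _.
rewrite le_eqVlt; apply/orP; left; apply/eqP.
by field; rewrite gt_eqF.
Qed.

Lemma expected_loss_le T : (0 < T)%N ->
  expected_loss vbar rho T <=
  loss_factor * ((1 + log_rate R T) ^+ 2 * Num.sqrt T%:R).
Proof.
move=> T0; rewrite /expected_loss /loss_factor.
have reg := regret_bound_le T0.
have K0 := log_rate_ge0 R T; set K := log_rate R T in K0 reg *.
have s1 : 1 <= Num.sqrt T%:R :> R by rewrite -[leLHS]sqrtr1 ler_wsqrtr// ler1n.
have iv := sum_invsqrt_le R T.
set s := Num.sqrt T%:R in s1 reg iv *.
have first_round : \sum_(k < T) ((k : nat) == 0%N)%:R <= 1 :> R.
  case: (T) T0 => // n _; rewrite big_ord_recl /= big1 ?addr0// => k _.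
have epsK : \sum_(k < T) eps_t R T k <= K * (2 * s).
  apply: (@le_trans _ _ (\sum_(k < T) K * (Num.sqrt k%:R)^-1)).
    by apply: ler_sum => k _; exact: eps_le_rate.
  by rewrite -mulr_sumr ler_wpM2l.
have -> : \sum_(k < T) (3 * (vbar * (Num.sqrt k%:R)^-1)
    + 3 * (vbar * ((k : nat) == 0%N)%:R) + 3 * eps_t R T k * vbar) =
  3 * vbar * (\sum_(k < T) (Num.sqrt k%:R)^-1
    + \sum_(k < T) ((k : nat) == 0%N)%:R + \sum_(k < T) eps_t R T k).
  rewrite -!big_split /= mulr_sumr; apply: eq_bigr => k _; ring.
set A := \sum_(k < T) _ + _ + _.
have hA : A <= 3 * (1 + K) * s.
  have : 1 * 1 <= s by rewrite mulr1.
  have : 0 <= K * s by rewrite mulr_ge0//; lra.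
  rewrite /A; lra.
have W1 : 1 <= (1 + K) ^+ 2 by rewrite expr_ge1//; lra.
have KW : 1 + K <= (1 + K) ^+ 2 by rewrite expr2 ler_peMr//; lra.
have Ws : (1 + K) * s <= (1 + K) ^+ 2 * s by rewrite ler_wpM2r//; lra.
have sW : s <= (1 + K) ^+ 2 * s by rewrite ler_peMl//; lra.
set X := (1 + K) ^+ 2 * s in reg Ws sW *.
(* The three terms are at most [X], [3 * X] and [9 * X], so [19] leaves room. *)
have total : 1 + 3 * s + 3 * A <= 19 * X by lra.
have := ler_wpM2l (ltW vbar_gt0) total; lra.
Qed.

Lemma loss_rate T : (0 < T)%N ->
  T%:R^-1 * expected_loss vbar rho T <=
  20 * loss_factor / Num.sqrt (Num.sqrt T%:R).
Proof.
move=> T0; have T1 : 1 <= T%:R :> R by rewrite ler1n.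
have lf0 : 0 <= loss_factor.
  by rewrite mulr_ge0 ?(ltW vbar_gt0)// addr_ge0// sqr_ge0.
have lnT := ln_le_fourth_root R T0.
have u1 : 1 <= Num.sqrt (Num.sqrt T%:R) :> R.
  by rewrite -[leLHS]sqrtr1 ler_wsqrtr// -[leLHS]sqrtr1 ler_wsqrtr.
have Tu : Num.sqrt T%:R = Num.sqrt (Num.sqrt T%:R) ^+ 2 :> R.
  by rewrite sqr_sqrtr// sqrtr_ge0.
have TE : T%:R = Num.sqrt (Num.sqrt T%:R) ^+ 4 :> R.
  by rewrite (exprM _ 2 2) -Tu sqr_sqrtr// ler0n.
have K2 : log_rate R T ^+ 2 = ln 2 + 2 * ln T%:R.
  by rewrite /log_rate sqr_sqrtr// log_arg_ge0.
have ln2 : ln 2 <= 1 :> R.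
  have := @le_ln1Dx R 1; rewrite (_ : 1 + 1 = 2)//; apply; lra.
(* With [K] the rate and [u] the fourth root: [(1 + K) ^+ 2 <= 2 + 2 * K ^+ 2 <= 4 + 16 * u <= 20 *
   u]. *)
have W2 : (1 + log_rate R T) ^+ 2 <= 20 * Num.sqrt (Num.sqrt T%:R).
  have : 0 <= (log_rate R T - 1) ^+ 2 by exact: sqr_ge0.
  lra.
apply: (@le_trans _ _ (T%:R^-1 * (loss_factor *
   (20 * Num.sqrt (Num.sqrt T%:R) * Num.sqrt T%:R)))).
  rewrite ler_wpM2l ?invr_ge0 ?ler0n//.
  apply: le_trans (expected_loss_le T0) _.
  by rewrite ler_wpM2l// ler_wpM2r// sqrtr_ge0.
set u := Num.sqrt (Num.sqrt T%:R) in u1 Tu TE *.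
rewrite Tu TE le_eqVlt; apply/orP; left; apply/eqP.
by field; rewrite gt_eqF// (lt_le_trans _ u1).
Qed.

End LossRate.

(** * Vanishing average loss, uniformly in the values and the price distribution *)

Lemma hindsight_ext (R : realType) (rho : R) (T : nat) (v v' p : nat -> R) :
    (forall j, (j < T)%N -> v j = v' j) ->
  hindsight rho T v p = hindsight rho T v' p.
Proof.
move=> E; apply: eq_big => [x|x _].
  by congr (_ <= _); apply: eq_bigr => k _; rewrite E.
by apply: eq_bigr => k _; rewrite E.
Qed.

Theorem theorem5 (R : realType) (vbar rho : R) :
  0 < vbar -> 0 < rho -> rho <= vbar ->
  forall eps : R, 0 < eps ->
  exists T0 : nat, forall T : nat, (T0 <= T)%N ->
  forall v : nat -> R, (forall t, (t < T)%N -> 0 <= v t <= vbar) ->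
  forall G : probability R R, G `[0, vbar] = 1%E ->
  - eps <= (T%:R)^-1 *
    Eprod G T (fun s =>
      ogdcb_revenue vbar rho T v (fun t => nth 0 s t)
      - rho / vbar * hindsight rho T v (fun t => nth 0 s t)).
Proof.
move=> vbar_gt0 rho_gt0 rho_le eps eps_gt0.
set M := 20 * loss_factor vbar rho / eps.
have M0 : 0 <= M.
  rewrite divr_ge0 ?(ltW eps_gt0)// mulr_ge0// mulr_ge0 ?(ltW vbar_gt0)//.
  by rewrite addr_ge0// sqr_ge0.
(* Once the fourth root of [T] reaches [M], the bound of [loss_rate] is at most [eps]; the successor
   makes [T] positive. *)
exists (Num.bound (M ^+ 4)).+1 => T ltT v v_bounds G GD.
have T_gt0 : (0 < T)%N by exact: leq_ltn_trans ltT.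
(* The values are bounded only within the horizon; setting them to [0] beyond it gives bounds at
   every index and changes neither revenue nor benchmark. *)
pose v' t := if (t < T)%N then v t else 0.
have vE t : (t < T)%N -> v t = v' t by rewrite /v' => ->.
have v'_bounds t : 0 <= v' t <= vbar.
  by rewrite /v'; case: ltnP => [/v_bounds//|_]; rewrite lexx ltW.
have -> : (fun s => ogdcb_revenue vbar rho T v (fun t => nth 0 s t)
      - rho / vbar * hindsight rho T v (fun t => nth 0 s t)) =
    (fun s => ogdcb_revenue vbar rho T v' (fun t => nth 0 s t)
      - rho / vbar * hindsight rho T v' (fun t => nth 0 s t)).
  apply/funext => s; rewrite (hindsight_ext _ _ vE) /ogdcb_revenue.
  by rewrite (@ogd_run_ext _ _ _ _ v v' _ (fun t => nth 0 s t))// => j /vE.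
have main := expected_revenue_bound vbar_gt0 rho_gt0 rho_le T_gt0 v'_bounds GD.
have Tinv0 : 0 <= T%:R^-1 :> R by rewrite invr_ge0.
apply: le_trans (ler_wpM2l Tinv0 main).
rewrite mulrN lerN2; apply: le_trans (loss_rate vbar_gt0 rho_gt0 T_gt0) _.
set u := Num.sqrt (Num.sqrt T%:R).
have u0 : 0 < u by rewrite !sqrtr_gt0 ltr0n.
have uE : u ^+ 4 = T%:R by rewrite (exprM _ 2 2) !sqr_sqrtr ?sqrtr_ge0.
rewrite ler_pdivrMr// [eps * u]mulrC -ler_pdivrMr// -/M.
rewrite -(ler_pXn2r (n := 4)) ?nnegrE ?(ltW u0)// uE ltW//.
apply: lt_le_trans (archi_boundP _) _; first exact: exprn_ge0.
by rewrite ler_nat; exact: ltnW.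
Qed.
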